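(* For every lobster graph $L$ with diameter $d\geq 5$, we have $p(L)\leq d-1$, where $p(L)$ denotes the optimal-pegging number of $L$.
   Context: A distribution $D$ of pegs on a graph $G$ is a subset of $V(G)$ (the vertices holding one peg each). A pegging move from $D$ to $D'$: there are distinct vertices $u,v\in D$ and $w\notin D$ with both $u$ and $w$ adjacent to $v$, and $D'=(D\setminus\{u,v\})\cup\{w\}$. A vertex $x$ is reachable from $D$ if some finite (possibly empty) sequence of pegging moves starting at $D$ yields a distribution containing $x$. The reach $R(D)$ is the set of vertices reachable from $D$; $G$ can be pegged by $D$ if $R(D)=V(G)$. The optimal-pegging number $p(G)$ is the minimum size of a distribution on $G$ that can peg $G$. A caterpillar graph is a tree such that if all leaves (vertices of degree $1$) and their incident edges are removed, the remainder of the graph forms a path. A lobster graph is a tree such that if all leaves and their incident edges are removed, the remainder of the graph is a caterpillar. *)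

(* Defs.v *)
From mathcomp Require Import all_boot.

Set Implicit Arguments.
Unset Strict Implicit.
Unset Printing Implicit Defensive.

Record sgraph := SGraph {
  vertex :> finType;
  adj : rel vertex;
  adj_sym : symmetric adj;
  adj_irrefl : irreflexive adj }.

Section Graphs.
Variable G : sgraph.
Implicit Types (x y u v w : G) (D A : {set G}).

Definition deg x : nat := #|[set y | adj x y]|.

Definition leaf x : bool := deg x == 1.

Definition connected : Prop := 0 < #|G| /\ forall x y, connect (@adj G) x y.

(* Since [adj] is symmetric, [:: x; y] is a [cycle] as soon as x and y are
   adjacent, hence the lower bound on the size. *)
Definition acyclic : Prop :=
  forall c : seq G, 2 < size c -> ~ ucycle (@adj G) c.

Definition is_tree : Prop := connected /\ acyclic.

(* The null graph and the one-vertex graph count as paths, so that stars and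
   the one-edge tree are caterpillars. *)
Definition is_path : Prop :=
  exists (n : nat) (f : 'I_n -> G),
    bijective f /\
    forall i j, adj (f i) (f j) = (i.+1 == j :> nat) || (j.+1 == i :> nat).

Definition walk (n : nat) x y : bool :=
  [exists p : n.-tuple G, path (@adj G) x p && (last x p == y)].

(* A shortest walk visits no vertex twice, so its length is less than #|G|;
   between vertices of different components the value is #|G|. *)
Definition dist x y : nat := find (fun n => walk n x y) (iota 0 #|G|).

Definition diam : nat := \max_(x : G) \max_(y : G) dist x y.

Definition pegging_move : rel {set G} := fun D D' =>
  [exists u, exists v, exists w,
    [&& u != v, u \in D, v \in D, w \notin D, adj u v, adj w v
      & D' == w |: (D :\: [set u; v])]].

Definition reach D : {set G} :=
  [set x | [exists D', connect pegging_move D D' && (x \in D')]].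

Definition can_peg D : bool := reach D == [set: G].

Definition pegging_number : nat :=
  #|[arg min_(D < [set: G] | can_peg D) #|D|]|.

Lemma walkP n x y :
  reflect (exists p : seq G,
             [/\ size p = n, path (@adj G) x p & last x p = y])
          (walk n x y).
Proof.
apply: (iffP existsP) => [[p /andP[pP /eqP pl]]|[p [sp pP pl]]].
  by exists p; rewrite size_tuple.
have sp' : size p == n by apply/eqP.
by exists (Tuple sp'); rewrite /= pP pl eqxx.
Qed.

Lemma dist_min n x y : walk n x y -> dist x y <= n.
Proof.
move=> wn; rewrite leqNgt; apply/negP => lt_nd.
have lt_nG : n < #|G|.
  by apply: leq_trans lt_nd _; rewrite -[leqRHS](size_iota 0) find_size.
by have := before_find 0 lt_nd; rewrite nth_iota // add0n wn.
Qed.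

Lemma dist_walk x y : connect (@adj G) x y -> walk (dist x y) x y.
Proof.
case/connectP => p /shortenP[q qP uq _] ->.
have lt_qG : size q < #|G|.
  by have := max_card (mem (x :: q)); rewrite (card_uniqP uq).
have h : has (fun n => walk n x (last x q)) (iota 0 #|G|).
  apply/hasP; exists (size q); first by rewrite mem_iota.
  by apply/walkP; exists q.
have lt_d : dist x (last x q) < #|G|.
  by rewrite /dist -[ltnRHS](size_iota 0) -has_find.
by have := nth_find 0 h; rewrite nth_iota // add0n.
Qed.

Lemma can_peg_setT : can_peg [set: G].
Proof.
apply/eqP/setP => x; rewrite !inE; apply/existsP.
by exists [set: G]; rewrite connect0 inE.
Qed.

Lemma pegging_numberP :
  (exists2 D, can_peg D & #|D| = pegging_number) /\
  (forall D, can_peg D -> pegging_number <= #|D|).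
Proof.
rewrite /pegging_number; case: arg_minnP; first exact: can_peg_setT.
by move=> D pD minD; split; [exists D | exact: minD].
Qed.

End Graphs.

Section Induced.
Variables (G : sgraph) (A : {set G}).

Definition induced_adj : rel {x : G | x \in A} :=
  fun x y => adj (val x) (val y).

Fact induced_adj_sym : symmetric induced_adj.
Proof. by move=> x y; rewrite /induced_adj adj_sym. Qed.

Fact induced_adj_irrefl : irreflexive induced_adj.
Proof. by move=> x; rewrite /induced_adj adj_irrefl. Qed.

Definition induced : sgraph := SGraph induced_adj_sym induced_adj_irrefl.

End Induced.

Definition remove_leaves (G : sgraph) : sgraph :=
  induced [set x : G | ~~ leaf x].

Definition is_caterpillar (G : sgraph) : Prop :=
  is_tree G /\ is_path (remove_leaves G).

Definition is_lobster (G : sgraph) : Prop :=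
  is_tree G /\ is_caterpillar (remove_leaves G).

(* Main.v *)
Require Import Defs.
From mathcomp Require Import all_boot.

Set Implicit Arguments.
Unset Strict Implicit.
Unset Printing Implicit Defensive.

(** Removing the leaves of the lobster [L] twice leaves a path [t], the spine,
with [n] vertices.  If [n > 0], every vertex of [L] is within distance 2 of the
spine: a leaf hangs from a vertex that survives the removal, unless the whole tree is
a single edge ([near_peeled]).

Size of the distribution.  Restoring the leaves increases the diameter by at
most 2 ([diam_leq_remove_leaves]), so a diameter of at least 5 forces
[n >= 2].  An end of the spine is not a leaf of the caterpillar that remains
after the first removal, so the spine extends in that caterpillar by one vertex
at each end, to a path [m] with [n + 2] vertices.  The ends of [m] are in turn
not leaves of [L], so [m] extends in [L] by one more vertex at each end
([extend_peeled_path] gives both extensions).  In a tree a simple path is a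
geodesic, hence [n + 3 <= d] ([acyclic_simple_path_leq_diam]) and putting
one peg on each vertex of [m] uses at most [d - 1] pegs.

Pegging.  Each spine vertex [w] is an inner vertex of [m], so it and a
neighbour are pegged, and one move reaches any neighbour of [w].  To reach [x]
at distance 2 from [w], through [u], use that [m] has at least four
vertices: on one of the two sides of [w] it continues by two vertices [b, c],
and on the other side there is a neighbour [a] of [w].  The moves
[a, w -> u], then [c, b -> w], then [w, u -> x] peg [x]
([reach_dist2]). *)

(** * Simple paths in acyclic graphs *)

Lemma rev_sorted_sym (T : Type) (e : rel T) (s : seq T) :
  symmetric e -> sorted e (rev s) = sorted e s.
Proof.
by move=> e_sym; rewrite rev_sorted; apply: eq_sorted => x y; rewrite e_sym.
Qed.

Section Acyclic.
Variable G : sgraph.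
Implicit Types (x y z w : G) (p q r s : seq G).

(** A path from [z] to [w] that avoided [x] would close up through [x] to a
cycle.  This is the only way in which acyclicity is exploited below. *)
Lemma acyclic_neighbours_separated x z w r :
  acyclic G -> adj x z -> adj x w -> z != w ->
  path (@adj G) z r -> last z r = w -> x \in z :: r.
Proof.
move=> acG xz xw zw rP rl; apply: contraT => xNr; exfalso.
case/shortenP: rP rl => r' r'P r'U sub r'l.
apply: (acG (x :: z :: r')).
  by case: r' r'l zw {r'P r'U sub} => //= ->; rewrite eqxx.
rewrite /ucycle /= rcons_path xz r'P r'l adj_sym xw /=.
move: r'U => /= ->; rewrite andbT.
by apply: contra xNr; rewrite !inE => /orP[->//|/sub ->]; rewrite orbT.
Qed.

(** At the first divergence, after [x], following one path to the common end
and returning along the other joins two distinct neighbours of [x] without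
visiting [x]. *)
Lemma acyclic_simple_path_unique x p q :
  acyclic G -> path (@adj G) x p -> path (@adj G) x q ->
  uniq (x :: p) -> uniq (x :: q) -> last x p = last x q -> p = q.
Proof.
move=> acG; elim: p x q => [|z p IHp] x [|w q] //=.
- by move=> _ _ _ /andP[xNq _] xl; rewrite xl mem_last in xNq.
- by move=> _ _ /andP[xNp _] _ xl; rewrite -xl mem_last in xNp.
move=> /andP[xz pP] /andP[xw qP] /andP[xNp pU] /andP[xNq qU] pq.
have [zw|zNw] := eqVneq z w; first by subst w; congr cons; apply: IHp pq.
have: x \in z :: (p ++ rev (belast w q)).
  apply: acyclic_neighbours_separated acG xz xw zNw _ _.
    rewrite cat_path pP pq rev_path.
    by rewrite (eq_path (e' := @adj G)) // => u v; rewrite adj_sym.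
  by rewrite last_cat pq; case: (q) => //= v r; rewrite rev_cons last_rcons.
rewrite -cat_cons mem_cat (negPf xNp) mem_rev => /mem_belast.
by rewrite (negPf xNq).
Qed.

(** A shortest walk between the ends of [p] can be shortened to a simple path,
which has to be [p] itself. *)
Lemma acyclic_simple_path_leq_diam x p :
  connected G -> acyclic G -> path (@adj G) x p -> uniq (x :: p) ->
  size p <= diam G.
Proof.
move=> [_ conG] acG pP pU; set y := last x p.
have le_diam : dist x y <= diam G.
  apply: leq_trans (leq_bigmax x); exact: (leq_bigmax (F := dist x) y).
apply: leq_trans le_diam.
have /walkP[q [<- qP]] := dist_walk (conG x y).
case/shortenP: qP => q' q'P q'U sub ql.
rewrite (acyclic_simple_path_unique acG pP q'P pU q'U (esym ql)).
by apply: uniq_leq_size => //; case/andP: q'U.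
Qed.

Lemma second_neighbour x y :
  ~~ leaf x -> adj x y -> exists2 z, adj x z & z != y.
Proof.
rewrite /leaf /deg => xNleaf xy.
case: (pickP [pred z | adj x z & z != y]) => [z /andP[]|none]; first by exists z.
case/negP: xNleaf; rewrite (_ : [set z | _] = [set y]) ?cards1 //.
apply/setP=> z; rewrite !inE; apply/idP/eqP=> [xz|->//].
by have := none z; rewrite /= xz /= => /negbFE/eqP.
Qed.

(** A second neighbour [z] of the non-leaf [x] cannot lie on [s]: if it did, the
part of [s] up to [z] would join two neighbours of [x] without visiting
[x]. *)
Lemma extend_simple_path x s :
  acyclic G -> ~~ leaf x -> 0 < size s ->
  sorted (@adj G) (x :: s) -> uniq (x :: s) ->
  exists z, sorted (@adj G) [:: z, x & s] && uniq [:: z, x & s].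
Proof.
case: s => [|y s] // acG xNleaf _ sP sU.
have /andP[xy yP] : adj x y && path (@adj G) y s by [].
have [z xz zNy] := second_neighbour xNleaf xy.
exists z; rewrite cons_uniq sU andbT /=.
rewrite adj_sym xz xy yP inE negb_or /=; apply/andP; split.
  by apply: contraTneq xz => ->; rewrite adj_irrefl.
apply/negP => zs.
case/andP: sU => /negP xNs _; apply: xNs.
case/splitPl: zs yP => s1 s2 s1l; rewrite cat_path => /andP[s1P _].
have: x \in y :: s1.
  by apply: acyclic_neighbours_separated s1P s1l; rewrite // eq_sym.
by rewrite -cat_cons mem_cat => ->.
Qed.

End Acyclic.

(** * Removing leaves *)

Section RemoveLeaves.
Variable G : sgraph.

Definition unpeel (x : remove_leaves G) : G := val x.

Lemma unpeel_inj : injective unpeel.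
Proof. exact: val_inj. Qed.

Lemma unpeel_nonleaf x : ~~ leaf (unpeel x).
Proof. by have := valP x; rewrite inE. Qed.

Lemma nonleaf_unpeel (x : G) : ~~ leaf x -> exists x', x = unpeel x'.
Proof.
move=> xN; have xin : x \in [set x : G | ~~ leaf x] by rewrite inE.
by exists (Sub x xin).
Qed.

Lemma sorted_unpeel (s : seq (remove_leaves G)) :
  sorted (@adj G) (map unpeel s) = sorted (@adj (remove_leaves G)) s.
Proof. by rewrite sorted_map. Qed.

(** The vertices of [s] survive the removal of leaves, so they are not leaves of
[G] and [extend_simple_path] applies at both ends, after a reversal for the
second one.  Two vertices are required so that each end has a neighbour on
the path from which its second neighbour differs. *)
Lemma extend_peeled_path (s : seq (remove_leaves G)) :
  acyclic G -> 1 < size s ->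
  sorted (@adj (remove_leaves G)) s -> uniq s ->
  exists a c, let s' := a :: rcons (map unpeel s) c in
    sorted (@adj G) s' && uniq s'.
Proof.
move=> acG; rewrite -sorted_unpeel -(map_inj_uniq unpeel_inj).
case: s => [|x s] // s_gt0; rewrite map_cons => sP sU.
have s'_gt0 : 0 < size (map unpeel s) by rewrite size_map.
have [a /andP[]] :=
  extend_simple_path acG (unpeel_nonleaf x) s'_gt0 sP sU.
rewrite -map_cons.
case/lastP: s s_gt0 {s'_gt0 sP sU} => [|s y] // _.
rewrite -rcons_cons map_rcons; set t := map _ _ => tP tU.
rewrite -(rev_sorted_sym _ (@adj_sym G)) -rcons_cons rev_rcons in tP.
rewrite -rev_uniq -rcons_cons rev_rcons in tU.
have t_gt0 : 0 < size (rev (a :: t)) by rewrite size_rev.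
have [c /andP[cP cU]] := extend_simple_path acG (unpeel_nonleaf y) t_gt0 tP tU.
exists a, c; cbv zeta; rewrite -(rev_sorted_sym _ (@adj_sym G)) -rev_uniq.
by rewrite -!rcons_cons !rev_rcons cP cU.
Qed.

(** No walk can leave an edge whose two ends are leaves. *)
Lemma adjacent_leaves_only (x y z : G) :
  connected G -> leaf x -> leaf y -> adj x y -> z \in [:: x; y].
Proof.
move=> [_ conG] /eqP dx /eqP dy xy.
have nbr (u v w : G) : deg u = 1 -> adj u v -> adj u w -> w = v.
  move/eqP/cards1P => [t ut] uv uw.
  have /set1P -> : v \in [set t] by rewrite -ut inE.
  by apply/set1P; rewrite -ut inE.
have /connectP[p pP ->] := conG x z.
suff closed (u : G) q :
    u \in [:: x; y] -> path (@adj G) u q -> last u q \in [:: x; y].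
  by rewrite closed ?mem_head.
elim: q u => [|v q IHq] u //= u_in /andP[uv qP].
apply: IHq => {qP} //; rewrite !inE in u_in *.
case/orP: u_in => /eqP u_eq; subst u.
- by rewrite (nbr x y v dx xy uv) eqxx orbT.
- by rewrite (nbr y x v dy _ uv) ?eqxx // adj_sym.
Qed.

(** The second alternative is the graph with a single edge, where the removal of
leaves leaves nothing. *)
Lemma near_peeled (x : G) : connected G ->
  (exists x', (x == unpeel x') || adj x (unpeel x')) \/
  (exists y, [/\ leaf x, leaf y, adj x y & forall z, z \in [:: x; y]]).
Proof.
move=> conG; have [xL|/nonleaf_unpeel[x' ->]] := boolP (leaf x); last first.
  by left; exists x'; rewrite eqxx.
have /cards1P[y /setP/(_ y)] := xL; rewrite !inE eqxx => xy.
have [yL|/nonleaf_unpeel[y' y_eq]] := boolP (leaf y).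
  by right; exists y; split=> // z; apply: adjacent_leaves_only.
by left; exists y'; rewrite -y_eq xy orbT.
Qed.

Lemma near_peeled_nonleaf (x : G) (z' : remove_leaves G) : connected G ->
  exists x', (x == unpeel x') || adj x (unpeel x').
Proof.
move=> /(near_peeled x)[//|[y [xL yL _ /(_ (unpeel z'))]]].
have := unpeel_nonleaf z'.
by rewrite !inE => /negP zN /orP[]/eqP z_eq; case: zN; rewrite z_eq.
Qed.

End RemoveLeaves.

(** [dist] takes a junk value between different components; explicit walks make
the bound meaningful there, and they can be concatenated. *)
Definition diam_leq (G : sgraph) (k : nat) :=
  forall x y : G, exists p, [/\ path (@adj G) x p, last x p = y & size p <= k].

Lemma diam_leqW G k : diam_leq G k -> diam G <= k.
Proof.
move=> Gk; apply/bigmax_leqP => x _; apply/bigmax_leqP => y _.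
have [p [pP pl pk]] := Gk x y.
by apply: leq_trans pk; apply: dist_min; apply/walkP; exists p.
Qed.

Lemma diam_leq_remove_leaves G k :
  connected G -> diam_leq (remove_leaves G) k -> diam_leq G k.+2.
Proof.
move=> conG Gk x y.
have [[x' xx']|[z [_ _ xz all]]] := near_peeled x conG; last first.
  have := all y; rewrite !inE => /orP[]/eqP->; first by exists [::].
  by exists [:: z]; rewrite /= xz.
have [y' yy'] := near_peeled_nonleaf y x' conG.
have [p [pP pl pk]] := Gk x' y'.
have [q [qP ql qk]] : exists q,
    [/\ path (@adj G) x q, last x q = unpeel y' & size q <= k.+1].
  have mP : path (@adj G) (unpeel x') (map (@unpeel G) p) by rewrite path_map.
  have ml : last (unpeel x') (map (@unpeel G) p) = unpeel y'.
    by rewrite last_map pl.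
  case/orP: xx' => [/eqP->|xx'].
    by exists (map (@unpeel G) p); rewrite size_map; split=> //; apply: leqW.
  by exists (unpeel x' :: map (@unpeel G) p); rewrite /= xx' size_map.
case/orP: yy' => [/eqP->|yy']; first by exists q; split=> //; apply: leqW.
exists (rcons q y).
by rewrite rcons_path last_rcons qP ql adj_sym yy' size_rcons.
Qed.

(** * Reaching vertices near a pegged path *)

Section Reach.
Variable G : sgraph.
Implicit Types (D : {set G}) (u v w x : G).

Lemma reach_mem D x : x \in D -> x \in reach D.
Proof. by move=> xD; rewrite inE; apply/existsP; exists D; rewrite connect0. Qed.

Lemma reach_move D u v w x :
  u != v -> u \in D -> v \in D -> w \notin D -> adj u v -> adj w v ->
  x \in reach (w |: (D :\: [set u; v])) -> x \in reach D.
Proof.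
move=> uNv uD vD wND uv wv; rewrite !inE => /existsP[D' /andP[DD' xD']].
apply/existsP; exists D'; rewrite xD' andbT; apply: connect_trans DD'.
apply: connect1; apply/existsP; exists u; apply/existsP; exists v.
by apply/existsP; exists w; rewrite uNv uD vD wND uv wv eqxx.
Qed.

(** If [x] is unpegged, the peg on [u] jumps over [v]. *)
Lemma reach_neighbour D u v x :
  u \in D -> v \in D -> adj u v -> adj x v -> x \in reach D.
Proof.
move=> uD vD uv xv; have [xD|xND] := boolP (x \in D); first exact: reach_mem.
apply: (@reach_move _ u v x) => //; last by rewrite reach_mem ?inE ?eqxx.
by apply: contraTneq uv => ->; rewrite adj_irrefl.
Qed.

(** If [u] is unpegged, the pair [a, w] pegs it but loses [w]; the pair [c, b]
then restores [w], and [w, u] finally peg [x]. *)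
Lemma reach_dist2 D a w b c u x :
  {subset [:: a; w; b; c] <= D} -> uniq [:: a; w; b; c] ->
  sorted (@adj G) [:: a; w; b; c] -> adj u w -> adj x u -> x \in reach D.
Proof.
move=> sub abU /and4P[aw wb bc _] uw xu.
have [aD wD bD cD] : [/\ a \in D, w \in D, b \in D & c \in D].
  by split; apply: sub; rewrite !inE eqxx ?orbT.
have [xD|xND] := boolP (x \in D); first exact: reach_mem.
have [uD|uND] := boolP (u \in D).
  by apply: (@reach_neighbour _ w u); rewrite // adj_sym.
have uNw : u != w by apply: contraTneq wD => <-.
rewrite /= !inE !negb_or in abU.
case/and4P: abU => /and3P[aNw aNb aNc] /andP[wNb wNc] bNc _.
apply: (@reach_move _ a w u) => //.
apply: (@reach_move _ c b w); last first.
- apply: (@reach_neighbour _ w u); last exact: xu; last by rewrite adj_sym.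
    by rewrite !inE eqxx.
  have uN v : v \in D -> u == v = false.
    by move=> vD; apply: contraNF uND => /eqP->.
  by rewrite !inE eqxx !uN.
- exact: wb.
- by rewrite adj_sym.
- by rewrite !inE eqxx orbT orbF eq_sym.
- by rewrite !inE (eq_sym b a) (eq_sym b w) negb_or aNb wNb bD orbT.
- by rewrite !inE (eq_sym c a) (eq_sym c w) negb_or aNc wNc cD orbT.
- by rewrite eq_sym.
Qed.

Lemma reach_dist2_path_left (s1 s2 : seq G) w u x :
  let m := s1 ++ w :: s2 in
  0 < size s1 -> 1 < size s2 -> sorted (@adj G) m -> uniq m ->
  adj u w -> adj x u -> x \in reach [set y in m].
Proof.
case/lastP: s1 => [|s1 a] //; case: s2 => [|b [|c s2]] // m _ _ mP mU.
have mE : m = s1 ++ [:: a; w; b; c] ++ s2 by rewrite /m cat_rcons.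
apply: (@reach_dist2 _ a w b c).
- by move=> y yin; rewrite inE mE !mem_cat yin orbT.
- by move: mU; rewrite mE !cat_uniq => /and3P[_ _ /andP[]].
- by move: mP; rewrite mE => /cat_sorted2[_] /cat_sorted2[].
Qed.

(** A path with at least four vertices continues by two vertices on one side of
[w] at least; reversing it exchanges the two sides. *)
Lemma reach_dist2_path (s1 s2 : seq G) w u x :
  let m := s1 ++ w :: s2 in
  0 < size s1 -> 0 < size s2 -> 3 < size m ->
  sorted (@adj G) m -> uniq m ->
  adj u w -> adj x u -> x \in reach [set y in m].
Proof.
move=> m s1_gt0 s2_gt0 m_gt3 mP mU.
have [s2_gt1|s2_le1] := ltnP 1 (size s2); first exact: reach_dist2_path_left.
have s1_gt1 : 1 < size s1.
  move: m_gt3; rewrite /m size_cat /= addnS !ltnS => m_gt2.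
  by rewrite -(ltn_add2r 1); apply: leq_trans m_gt2 _; rewrite leq_add2l.
have mE : rev m = rev s2 ++ w :: rev s1 by rewrite rev_cat rev_cons cat_rcons.
have -> : [set y in m] = [set y in rev m].
  by apply/setP => y; rewrite !inE mem_rev.
rewrite mE; apply: reach_dist2_path_left; rewrite ?size_rev // -mE.
  by rewrite (rev_sorted_sym _ (@adj_sym G)).
by rewrite rev_uniq.
Qed.

End Reach.

(** * Lobsters *)

Lemma is_path_sorted (G : sgraph) : is_path G ->
  exists s : seq G, [/\ sorted (@adj G) s, uniq s & forall x, x \in s].
Proof.
case=> n [f [f_bij f_adj]]; exists (map f (enum 'I_n)); split.
- rewrite sorted_map (@eq_sorted _ _ (relpre val
    (fun i j : nat => (i.+1 == j) || (j.+1 == i)))); last exact: f_adj.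
  rewrite -sorted_map val_enum_ord.
  case: n {f f_bij f_adj} => // n /=.
  by elim: n 0 => //= n IHn i; rewrite eqxx IHn.
- by rewrite map_inj_uniq ?enum_uniq //; apply: bij_inj.
by move=> x; case: f_bij => g _ gK; rewrite -[x]gK map_f ?mem_enum.
Qed.

Theorem theorem6p6 (L : sgraph) (d : nat)
  (lobsterL : is_lobster L) (diamL : diam L = d) (d_ge5 : 5 <= d) :
  pegging_number L <= d - 1.
Proof.
case: lobsterL => [[conL acL] [[conC acC] pathP]].
have [t [tP tU t_all]] := is_path_sorted pathP.
(* With at most one spine vertex, the diameter would be at most 0 + 2 + 2. *)
have t_gt1 : 1 < size t.
  rewrite ltnNge; apply: contraL d_ge5 => t_le1; rewrite -ltnNge ltnS -diamL.
  apply/diam_leqW/diam_leq_remove_leaves/diam_leq_remove_leaves => // x y.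
  exists [::]; split=> //=.
  have [] := (t_all x, t_all y).
  by case: (t) t_le1 => [|z [|]] //= _; rewrite !inE => /eqP-> /eqP->.
have [a [c /andP[mP mU]]] := extend_peeled_path acC t_gt1 tP tU.
set m := a :: _ in mP mU.
have size_m : size m = (size t).+2 by rewrite /= size_rcons size_map.
have m_gt1 : 1 < size m by rewrite size_m.
have [b [e /andP[bP bU]]] := extend_peeled_path acL m_gt1 mP mU.
(* The extended path has [size m + 2] vertices, hence [size m + 1] edges. *)
have m_le_d : size m <= d - 1.
  have := acyclic_simple_path_leq_diam conL acL bP bU.
  by rewrite diamL size_rcons size_map; case: (d) => //= d'; rewrite subn1.
set D := [set x in map (@unpeel L) m].
have card_D : #|D| <= size m.
  by rewrite cardsE (leq_trans (card_size _)) ?size_map.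
apply: leq_trans (leq_trans card_D m_le_d).
apply: (pegging_numberP L).2; apply/eqP/setP => x; rewrite [RHS]inE.
rewrite -sorted_unpeel in mP; rewrite -(map_inj_uniq (@unpeel_inj L)) in mU.
have [x0 _] : exists x0, x0 \in t.
  by case: (t) t_gt1 => // x0 t' _; exists x0; apply: mem_head.
have [u xu] := near_peeled_nonleaf x (unpeel x0) conL.
have [w uw] := near_peeled_nonleaf u x0 conC.
have [t1 [t2 tE]] : exists t1 t2, t = t1 ++ w :: t2.
  by have /splitPr[t1 t2] := t_all w; exists t1, t2.
pose s1 := unpeel a :: map (@unpeel L) (map (@unpeel _) t1).
pose s2 := rcons (map (@unpeel L) (map (@unpeel _) t2)) (unpeel c).
have mE : map (@unpeel L) m = s1 ++ unpeel (unpeel w) :: s2.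
  by rewrite /m tE /= map_rcons !map_cat /= rcons_cat rcons_cons.
have s2_gt0 : 0 < size s2 by rewrite size_rcons.
have wD : unpeel (unpeel w) \in D by rewrite inE mE mem_cat mem_head orbT.
have reach_near y : adj y (unpeel (unpeel w)) -> y \in reach D.
  apply: (@reach_neighbour _ _ (last (unpeel a) s1)) => //.
    by rewrite inE mE mem_cat /s1 /= mem_last.
  by move: mP; rewrite mE /s1 /= cat_path /= => /and3P[].
case/orP: uw xu => [/eqP->|uw] /orP[/eqP->|xu].
- exact: reach_mem.
- exact: reach_near.
- exact: reach_near.
rewrite /D mE; apply: (reach_dist2_path (u := unpeel u)); rewrite -?mE //.
by rewrite size_map size_m.
Qed.
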